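(* Let $$F(t,X,Y)=F(t,x_2,x_3,\ldots,y_2,y_3,\ldots)=\sum_{n\ge0}\sum_{\pi\in\mathfrak M_n}t^n\prod_{j\ge2}x_j^{12\text{-}3\text{-}\ldots\text{-}j(\pi)}y_j^{21\text{-}3\text{-}\ldots\text{-}j(\pi)}.$$ Then $$F(t,X,Y)=1-\cfrac{t}{ty_2-\cfrac{1}{1+tx_2(1-y_2y_3)+tx_2y_2y_3F(t,X',Y')}},$$ where $X'=(x_2x_3,x_3x_4,\ldots)$ and $Y'=(y_2y_3,y_3y_4,\ldots)$ (i.e. $F(t,X',Y')$ is obtained by substituting $x_j\mapsto x_jx_{j+1}$ and $y_j\mapsto y_jy_{j+1}$ for all $j\ge2$). Equivalently, $F$ is given by the continued fraction $$1-\cfrac{t}{ty_2-\cfrac{1}{1+tx_2-\cfrac{t^2x_2y_2y_3}{ty_2y_3-\cfrac{1}{1+tx_2x_3-\cfrac{t^2x_2x_3y_2y_3^2y_4}{ty_2y_3^2y_4-\cfrac{1}{1+tx_2x_3^2x_4-\cfrac{t^2x_2x_3^2x_4y_2y_3^3y_4^3y_5}{\ddots}}}}}}}.$$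
   Context: A permutation $\pi=\pi_1\cdots\pi_n$ is a Motzkin permutation if it avoids the pattern $132$ (no $i<j<k$ with $\pi_i<\pi_k<\pi_j$) and there are no indices $a<b$ with $\pi_a<\pi_b<\pi_{b+1}$; $\mathfrak M_n$ is the set of them. For $j\ge2$, an occurrence of the generalized pattern $12\text{-}3\text{-}\ldots\text{-}j$ in $\pi$ is a choice of indices $i<i+1<i_3<\dots<i_j$ (the first two adjacent) with $\pi_i<\pi_{i+1}<\pi_{i_3}<\dots<\pi_{i_j}$; an occurrence of $21\text{-}3\text{-}\ldots\text{-}j$ is a choice of indices $i<i+1<i_3<\dots<i_j$ with $\pi_{i+1}<\pi_i<\pi_{i_3}<\dots<\pi_{i_j}$ (for $j=2$ these are the adjacent patterns $12$ and $21$). $12\text{-}3\text{-}\ldots\text{-}j(\pi)$ and $21\text{-}3\text{-}\ldots\text{-}j(\pi)$ denote the numbers of such occurrences. *)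

(* Defs.v *)
From HB Require Import structures.
From mathcomp Require Import all_boot all_fingroup all_algebra.
From mathcomp Require Import boolp.

Set Implicit Arguments.
Unset Strict Implicit.
Unset Printing Implicit Defensive.

Import GRing.Theory.
Local Open Scope ring_scope.

Record fps (R : Type) := Fps { fps_coef : nat -> R }.
Coercion fps_coef : fps >-> Funclass.

Lemma fpsP (R : Type) (f g : fps R) : f =1 g <-> f = g.
Proof. by split=> [|->//]; case: f g => f [g] /= /funext ->. Qed.

HB.instance Definition _ (R : Type) := gen_eqMixin (fps R).
HB.instance Definition _ (R : Type) := gen_choiceMixin (fps R).

Section FpsRing.
Variable R : comNzRingType.
Implicit Types f g h : fps R.

Definition fpsC (c : R) : fps R := Fps (fun n => if n == 0%N then c else 0).
Definition fpsT : fps R := Fps (fun n => (n == 1%N)%:R).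

Definition fps_opp f : fps R := Fps (fun n => - f n).
Definition fps_add f g : fps R := Fps (fun n => f n + g n).
Definition fps_mul f g : fps R := Fps (fun n => \sum_(i < n.+1) f i * g (n - i)%N).

Lemma fps_addA : associative fps_add.
Proof. by move=> f g h; apply/fpsP => n /=; rewrite addrA. Qed.
Lemma fps_addC : commutative fps_add.
Proof. by move=> f g; apply/fpsP => n /=; rewrite addrC. Qed.
Lemma fps_add0 : left_id (fpsC 0) fps_add.
Proof. by move=> f; apply/fpsP => n /=; rewrite if_same add0r. Qed.
Lemma fps_addN : left_inverse (fpsC 0) fps_opp fps_add.
Proof. by move=> f; apply/fpsP => n /=; rewrite if_same addNr. Qed.

HB.instance Definition _ :=
  GRing.isZmodule.Build (fps R) fps_addA fps_addC fps_add0 fps_addN.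

Lemma fps_mul_poly f g N n : (n <= N)%N ->
  fps_mul f g n = ((\poly_(i < N.+1) f i) * (\poly_(i < N.+1) g i))`_n.
Proof.
move=> le_nN; rewrite coefM; apply: eq_bigr => i _; rewrite !coef_poly.
have lt_iN : (i < N.+1)%N by apply: leq_trans (ltn_ord i) _.
have lt_niN : (n - i < N.+1)%N by rewrite ltnS (leq_trans (leq_subr _ _)).
by rewrite lt_iN lt_niN.
Qed.

Lemma fps_mulA : associative fps_mul.
Proof.
move=> f g h; apply/fpsP => n.
have coefMl (p q r : {poly R}) : (forall i, (i <= n)%N -> p`_i = q`_i) ->
    (p * r)`_n = (q * r)`_n.
  move=> pq; rewrite !coefM; apply: eq_bigr => i _.
  by congr (_ * _); apply: pq; rewrite -ltnS.
have trunc f1 g1 i : (i <= n)%N -> (\poly_(k < n.+1) fps_mul f1 g1 k)`_i =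
    ((\poly_(k < n.+1) f1 k) * (\poly_(k < n.+1) g1 k))`_i.
  by move=> le_in; rewrite coef_poly ltnS le_in (fps_mul_poly _ _ le_in).
rewrite !(fps_mul_poly _ _ (leqnn n)) mulrC (coefMl _ _ _ (trunc g h)).
by rewrite (coefMl _ _ _ (trunc f g)) mulrC mulrA.
Qed.

Lemma fps_mulC : commutative fps_mul.
Proof.
by move=> f g; apply/fpsP => n; rewrite !(fps_mul_poly _ _ (leqnn n)) mulrC.
Qed.

Lemma fps_mul1 : left_id (fpsC 1) fps_mul.
Proof.
move=> f; apply/fpsP => n /=; rewrite big_ord_recl /= mul1r subn0.
by rewrite big1 ?addr0 // => i _; rewrite mul0r.
Qed.

Lemma fps_mulDl : left_distributive fps_mul fps_add.
Proof.
move=> f g h; apply/fpsP => n /=; rewrite -big_split /=.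
by apply: eq_bigr => i _; rewrite mulrDl.
Qed.

Lemma fps_oner_neq0 : fpsC 1 != fpsC 0.
Proof. by apply/eqP => /fpsP /(_ 0%N) /eqP; rewrite /= oner_eq0. Qed.

HB.instance Definition _ := GRing.Zmodule_isComNzRing.Build (fps R)
  fps_mulA fps_mulC fps_mul1 fps_mulDl fps_oner_neq0.

(* As everywhere in MathComp, f^-1 is f itself when f is not invertible;
   [fps_unitP] below identifies the invertible series. *)
Definition fps_unit : pred (fps R) := fun f => `[< exists g, g * f = 1 >].

Definition fps_inv f : fps R :=
  if pselect (exists g, g * f = 1) is left e then projT1 (cid e) else f.

Lemma fps_mulV : {in fps_unit, left_inverse 1 fps_inv *%R}.
Proof.
move=> f /asboolP uf; rewrite /fps_inv; case: pselect => // e.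
exact: projT2 (cid e).
Qed.

Lemma fps_unitPl f g : g * f = 1 -> fps_unit f.
Proof. by move=> gf; apply/asboolP; exists g. Qed.

Lemma fps_inv_out : {in [predC fps_unit], fps_inv =1 id}.
Proof.
by move=> f /asboolP nuf; rewrite /fps_inv; case: pselect.
Qed.

HB.instance Definition _ := GRing.ComNzRing_hasMulInverse.Build (fps R)
  fps_mulV fps_unitPl fps_inv_out.

Lemma fps_coefM f g n : (f * g) n = \sum_(i < n.+1) f i * g (n - i)%N.
Proof. by []. Qed.

Lemma fps_coef1 n : (1 : fps R) n = (n == 0%N)%:R.
Proof. by rewrite /GRing.one /=; case: eqP. Qed.

Lemma fps_unitP f : f \is a GRing.unit <-> exists c : R, c * f 0%N = 1.
Proof.
split=> [uf | [c cf]].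
  exists (f^-1 0%N); have /fpsP/(_ 0%N) := mulVr uf.
  by rewrite fps_coefM big_ord1 fps_coef1.
pose next (s : seq R) :=
  c * ((size s == 0%N)%:R - \sum_(i < size s) s`_i * f (size s - i)%N).
pose s n := iter n (fun s => rcons s (next s)) [::].
have size_s n : size (s n) = n by elim: n => //= n IHn; rewrite size_rcons IHn.
have nth_s m n : (n < m)%N -> (s m)`_n = next (s n).
  elim: m => // m IHm; rewrite ltnS leq_eqVlt => /orP[/eqP -> | lt_nm] /=.
    by rewrite nth_rcons size_s ltnn eqxx.
  by rewrite nth_rcons size_s lt_nm IHm.
have fg1 : Fps (fun n => next (s n)) * f = 1.
  apply/fpsP => n; rewrite fps_coefM fps_coef1 big_ord_recr /= subnn.
  rewrite [next (s n) * _]mulrC /next size_s mulrA [f 0%N * c]mulrC cf mul1r.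
  rewrite addrC -[RHS]subr0 -addrA; congr (_ + _); apply/eqP.
  rewrite addrC subr_eq oppr0 add0r; apply/eqP.
  by apply: eq_bigr => i _; rewrite nth_s //= /next size_s.
by apply/unitrP; exists (Fps (fun n => next (s n))); rewrite [f * _]mulrC.
Qed.

(* Convergence for the t-adic topology. *)
Definition fps_cvg (u : nat -> fps R) f : Prop :=
  forall n, exists M, forall m, (M <= m)%N -> u m n = f n.

End FpsRing.

Arguments fpsT {R}.
Notation "c %:S" := (fpsC c) (at level 1, format "c %:S") : ring_scope.

Section Patterns.
Variable n : nat.
Implicit Type p : 'S_n.

Definition avoids132 p : bool :=
  [forall i : 'I_n, forall j : 'I_n, forall k : 'I_n,
     ~~ [&& i < j, j < k, p i < p k & p k < p j]%N].

Definition avoids1_23 p : bool :=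
  [forall a : 'I_n, forall b : 'I_n, forall b' : 'I_n,
     ~~ [&& a < b, b' == b.+1 :> nat, p a < p b & p b < p b']%N].

Definition motzkin_perms : {set 'S_n} :=
  [set p | avoids132 p && avoids1_23 p].

(* [s] lists the chosen indices i, i+1, i_3, ..., i_j. *)
Definition is_occ12 p (s : seq 'I_n) : bool :=
  if s is a :: b :: s' then
    [&& b == a.+1 :> nat, sorted ltn (map val s)
      & sorted ltn [seq val (p i) | i <- [:: a, b & s']]]
  else false.

Definition is_occ21 p (s : seq 'I_n) : bool :=
  if s is a :: b :: s' then
    [&& b == a.+1 :> nat, sorted ltn (map val s)
      & sorted ltn [seq val (p i) | i <- [:: b, a & s']]]
  else false.

Definition occ12 p (j : nat) : nat := #|[set s : j.-tuple 'I_n | is_occ12 p s]|.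
Definition occ21 p (j : nat) : nat := #|[set s : j.-tuple 'I_n | is_occ21 p s]|.

Lemma sorted_tuple_size j (s : j.-tuple 'I_n) :
  sorted ltn (map val s) -> (j <= n)%N.
Proof.
move=> /(sorted_uniq ltn_trans ltnn); rewrite (map_inj_uniq val_inj).
move=> /card_uniqP; rewrite size_tuple => <-.
by rewrite -[X in (_ <= X)%N]card_ord max_card.
Qed.

Lemma occ12_eq0 p j : (n < j)%N -> occ12 p j = 0%N.
Proof.
move=> lt_nj; apply: eq_card0 => s; rewrite inE; apply/negP => occ_s.
have /sorted_tuple_size : sorted ltn (map val s).
  by move: occ_s; case: (tval s) => [|a [|b s']] //= /and3P[].
by rewrite leqNgt lt_nj.
Qed.

Lemma occ21_eq0 p j : (n < j)%N -> occ21 p j = 0%N.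
Proof.
move=> lt_nj; apply: eq_card0 => s; rewrite inE; apply/negP => occ_s.
have /sorted_tuple_size : sorted ltn (map val s).
  by move: occ_s; case: (tval s) => [|a [|b s']] //= /and3P[].
by rewrite leqNgt lt_nj.
Qed.

End Patterns.

(* The variables x_2, x_3, ... and y_2, y_3, ... are arbitrary elements of a
   commutative ring R (x 0, x 1, y 0, y 1 are never used): taking for R the
   polynomial ring over int in the x_j, y_j gives the formal generating
   function, and substituting for the variables amounts to changing the
   arguments x and y.  By [occ12_eq0] and [occ21_eq0], the factors with j > n
   of the product over all j >= 2 are equal to 1. *)
Definition motzkin_gf (R : comNzRingType) (x y : nat -> R) : fps R :=
  Fps (fun n => \sum_(p in motzkin_perms n)
                  \prod_(2 <= j < n.+1) (x j ^+ occ12 p j * y j ^+ occ21 p j)).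

Definition shift_vars (R : comNzRingType) (x : nat -> R) : nat -> R :=
  fun j => x j * x j.+1.

(* x_2, x_2x_3, x_2x_3^2x_4, x_2x_3^3x_4^3x_5, ... for k = 0, 1, 2, 3, ... *)
Definition cf_mon (R : comNzRingType) (x : nat -> R) (k : nat) : R :=
  \prod_(i < k.+1) x i.+2 ^+ 'C(k, i).

(* The part of the continued fraction that starts at
     1 + t x_2^C(k,0) x_3^C(k,1) ... - (t^2 ...) / ...,
   cut after m further steps.  The cuts are made where the remaining fraction
   is a multiple of t: a cut after a partial denominator t y_2 ... would
   divide by a series without constant term.  Below, each expression of the
   form 1 + t ... has constant term 1 and each denominator t y - 1 / ... has
   constant term -1, so both are invertible by [fps_unitP]. *)
Fixpoint cf_tail (R : comNzRingType) (x y : nat -> R) (m k : nat) : fps R :=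
  let b := 1 + fpsT * (cf_mon x k)%:S in
  if m is m'.+1 then
    b - (fpsT ^+ 2 * (cf_mon x k)%:S * (cf_mon y k.+1)%:S)
        / (fpsT * (cf_mon y k.+1)%:S - 1 / cf_tail x y m' k.+1)
  else b.

Definition cf_convergent (R : comNzRingType) (x y : nat -> R) (m : nat) : fps R :=
  1 - fpsT / (fpsT * (cf_mon y 0%N)%:S - 1 / cf_tail x y m 0).

(* Main.v *)
Require Import Defs.
From HB Require Import structures.
From mathcomp Require Import all_boot all_fingroup all_algebra.
From mathcomp Require Import boolp.
From mathcomp Require Import zify ring.

Set Implicit Arguments.
Unset Strict Implicit.
Unset Printing Implicit Defensive.

Import GRing.Theory.

(* A Motzkin permutation with maximal entry M is either M t, or s m M t with
   s > m > t entrywise, where s and t are again Motzkin: avoiding 132 puts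
   everything before M above everything after it, and avoiding 1-23 forces the
   letter m just before M to be the smallest of those before M.  In the second
   case M extends each occurrence inside s to one longer occurrence, which
   accounts for the substitution x_j -> x_j x_(j+1), y_j -> y_j y_(j+1); the
   only new occurrences are 12 = m M, 21 = (last s) m, which M extends to 21-3,
   and 21 = M (first t).  Hence, with B = 1 + y_2 (F - 1),
     F = 1 + t B + t^2 x_2 (1 + y_2 y_3 (F' - 1)) B,
   which is the functional equation.  Its iterates satisfy the recursion of the
   continued fraction, and each level of nesting gains a factor t. *)

(** * Motzkin words *)

(** The recursion runs over the letter playing 1, which suits induction along a concatenation. *)
Fixpoint av132 (w : seq nat) : bool :=
  if w is a :: w' then
    pairwise (fun b c => ~~ ((a < c) && (c < b))) w' && av132 w'
  else true.

(** [sorted] compares only neighbours, which is the adjacency of 2 and 3 in the pattern. *)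
Fixpoint av1_23 (w : seq nat) : bool :=
  if w is a :: w' then
    sorted (fun b c => ~~ ((a < b) && (b < c))) w' && av1_23 w'
  else true.

Definition motzkin_word w := av132 w && av1_23 w.

(** A 132 crossing the cut would have its 1 in [s] and its 2 in [r], but no letter of [s] is below
    one of [r]. *)
Lemma av132_cat (s r : seq nat) :
  allrel (fun a c => c <= a) s r -> av132 (s ++ r) = av132 s && av132 r.
Proof.
elim: s => //= a s IHs; rewrite allrel_consl => /andP[ge_a ge_s].
rewrite IHs // andbA; congr (_ && _ && _); rewrite pairwise_cat.
have -> : allrel (fun b c => ~~ ((a < c) && (c < b))) s r.
  apply/allrelP => b c bs cr; move/allP: ge_a => /(_ c cr); lia.
rewrite andTb andb_idr // => _.
apply/(pairwiseP 0) => i j _ jr _.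
by have := allP ge_a _ (mem_nth 0 jr); rewrite /=; lia.
Qed.

(** A new last letter can only play 2, and here nothing exceeds it. *)
Lemma av132_rcons (s : seq nat) M :
  all (fun a => a < M) s -> av132 (rcons s M) = av132 s.
Proof.
elim: s => //= a s IHs /andP[aM sM]; rewrite IHs //; congr (_ && _).
rewrite pairwise_rcons andb_idl // => _.
by apply/allP => b /(allP sM) /=; lia.
Qed.

Lemma av1_23_cat (s r : seq nat) :
  allrel (fun a c => c <= a) s r -> av1_23 (s ++ r) = av1_23 s && av1_23 r.
Proof.
elim: s => //= a s IHs; rewrite allrel_consl => /andP[ge_a ge_s].
rewrite IHs // andbA; congr (_ && _ && _).
have path_r b : path (fun b c => ~~ ((a < b) && (b < c))) b r.
  elim: r b ge_a {IHs ge_s} => //= c r IHr b /andP[ca ra].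
  by rewrite IHr // andbT; lia.
case: s {IHs ge_s} => [|b s] /=; last by rewrite cat_path path_r andbT.
by case: r ge_a path_r => //= c r _ /(_ c) /andP[].
Qed.

(** The only new adjacent pair is [m M], and no earlier letter lies below [m]. *)
Lemma av1_23_rcons (s : seq nat) m M :
  all (fun a => m <= a) s -> av1_23 (rcons (rcons s m) M) = av1_23 (rcons s m).
Proof.
elim: s => //= a s IHs /andP[ma ms]; rewrite IHs //; congr (_ && _).
case: s ms {IHs} => [|b s] ms /=; first by rewrite !andbT; lia.
by rewrite rcons_path last_rcons andb_idr // => _; lia.
Qed.

Lemma motzkin_word_max M (t : seq nat) :
  all (fun a => a < M) t -> motzkin_word (M :: t) = motzkin_word t.
Proof.
move=> tM; rewrite -cat1s /motzkin_word av132_cat ?av1_23_cat //=;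
  by rewrite allrel1l; apply/allP => c /(allP tM) /ltnW.
Qed.

Lemma motzkin_word_max_min M m (s t : seq nat) :
    all (fun a => m < a) s -> all (fun a => a < M) s -> m < M ->
    all (fun a => a < m) t ->
  motzkin_word (s ++ m :: M :: t) = motzkin_word s && motzkin_word t.
Proof.
move=> ms sM mM tm.
(* Two cuts: first before [t], which lies below everything preceding it, then before [m], which lies
   below [s]. *)
have -> : s ++ m :: M :: t = rcons (rcons s m) M ++ t.
  by rewrite !cat_rcons.
have ge_t : allrel (fun a c => c <= a) (rcons (rcons s m) M) t.
  apply/allrelP => a c; rewrite !(mem_rcons, inE) => ha /(allP tm) /= cm.
  by case/or3P: ha => [/eqP->|/eqP->|/(allP ms) /=]; lia.
have ge_m : allrel (fun a c => c <= a) s [:: m].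
  by rewrite allrel1r; apply/allP => a /(allP ms) /ltnW.
rewrite /motzkin_word av132_cat // av1_23_cat // av132_rcons; last first.
  by rewrite all_rcons mM sM.
rewrite av1_23_rcons; last by apply/allP => a /(allP ms) /ltnW.
by rewrite -cats1 av132_cat // av1_23_cat // !andbT andbACA.
Qed.

(** A letter [a] before [M] and a larger [c] after it would give the 132 [a M c]. *)
Lemma av132_max (s t : seq nat) M :
    av132 (s ++ M :: t) -> all (fun a => a < M) t ->
  allrel (fun a c => c <= a) s t.
Proof.
elim: s => // a s IHs /= /andP[pw av] tM; rewrite allrel_consl IHs // andbT.
move: pw; rewrite pairwise_cat pairwise_cons => /and3P[_ _ /andP[aM _]].
by apply/allP => c ct; move: (allP aM c ct) (allP tM c ct) => /=; lia.
Qed.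

(** A letter below [m] would form 1-23 with [m M]. *)
Lemma av1_23_max (s t : seq nat) m M :
    av1_23 (s ++ m :: M :: t) -> m < M -> all (fun a => m <= a) s.
Proof.
elim: s => // a s IHs /= /andP[pw av] mM; rewrite IHs // andbT.
move: pw; case: s {IHs av} => [|b s] /=; first by lia.
by rewrite cat_path /= => /and3P[_ _ /andP[]]; lia.
Qed.

Lemma motzkin_word_addn n w :
  motzkin_word [seq n + i | i <- w] = motzkin_word w.
Proof.
congr (_ && _); elim: w => //= a w ->; congr (_ && _).
  by rewrite pairwise_map; apply: eq_pairwise => b c /=; rewrite !ltn_add2l.
by rewrite sorted_map; apply: eq_sorted => b c /=; rewrite !ltn_add2l.
Qed.

Lemma av132P w :
  reflect (forall i j k, i < j -> j < k -> k < size w ->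
             ~~ ((nth 0 w i < nth 0 w k) && (nth 0 w k < nth 0 w j)))
          (av132 w).
Proof.
apply: (iffP idP); elim: w => //= a w IHw.
  case/andP => /(pairwiseP 0) pw av [|i] [|j] [|k] //= ij jk kw.
  by apply: pw; rewrite ?inE; lia.
  exact: IHw.
move=> av; rewrite IHw ?andbT => [|i j k ij jk kw]; last first.
  exact: av i.+1 j.+1 k.+1 _ _ _.
apply/(pairwiseP 0) => j k; rewrite !inE => jw kw jk.
exact: av 0 j.+1 k.+1 _ _ _.
Qed.

Lemma av1_23P w :
  reflect (forall i j, i < j -> j.+1 < size w ->
             ~~ ((nth 0 w i < nth 0 w j) && (nth 0 w j < nth 0 w j.+1)))
          (av1_23 w).
Proof.
apply: (iffP idP); elim: w => //= a w IHw.
  case/andP => /(sortedP 0) pw av [|i] [|j] //= ij jw; first exact: pw.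
  exact: IHw.
move=> av; rewrite IHw ?andbT => [|i j ij jw]; last first.
  exact: av i.+1 j.+1 _ _.
by apply/(sortedP 0) => j jw; apply: av 0 j.+1 _ _.
Qed.

(** * Counting occurrences in words *)

(* The number of increasing subsequences of [w] of length [i] with all entries
   above [v]. *)
Fixpoint inc (v i : nat) (w : seq nat) : nat :=
  match w, i with
  | _, 0 => 1
  | [::], _ => 0
  | a :: w', i'.+1 => inc v i w' + (if v < a then inc a i' w' else 0)
  end.

(* The indices are shifted by 2: [c12 i] counts 12-3-...-(i+2). *)
Fixpoint c12 (i : nat) (w : seq nat) : nat :=
  if w is a :: w' then
    c12 i w' + (if w' is b :: w'' then
                  if a < b then inc b i w'' else 0
                else 0)
  else 0.

Fixpoint c21 (i : nat) (w : seq nat) : nat :=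
  if w is a :: w' then
    c21 i w' + (if w' is b :: w'' then
                  if b < a then inc a i w'' else 0
                else 0)
  else 0.

Lemma inc0 v w : inc v 0 w = 1.
Proof. by case: w. Qed.

Lemma inc_gt_size v i w : size w < i -> inc v i w = 0.
Proof.
elim: w v i => [|a w IHw] v [|i] //= lt_wi.
by rewrite !IHw ?if_same //; lia.
Qed.

Lemma c12_ge_size i w : size w <= i -> c12 i w = 0.
Proof.
elim: w => //= a w IHw lt_wi; rewrite IHw ?(ltnW lt_wi) //.
by case: w {IHw} lt_wi => // b w /= ?; rewrite inc_gt_size ?if_same //; lia.
Qed.

Lemma c21_ge_size i w : size w <= i -> c21 i w = 0.
Proof.
elim: w => //= a w IHw lt_wi; rewrite IHw ?(ltnW lt_wi) //.
by case: w {IHw} lt_wi => // b w /= ?; rewrite inc_gt_size ?if_same //; lia.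
Qed.

Lemma inc_le v i w : all (fun a => a <= v) w -> inc v i w = (i == 0).
Proof.
elim: w v i => [|a w IHw] v [|i] //= /andP[av wv].
by rewrite IHw // ltnNge av.
Qed.

Lemma inc_addn n v i w : inc (n + v) i [seq n + a | a <- w] = inc v i w.
Proof.
by elim: w v i => [|a w IHw] v [|i] //=; rewrite ltn_add2l !IHw.
Qed.

Lemma c12_addn n i w : c12 i [seq n + a | a <- w] = c12 i w.
Proof.
elim: w => //= a w ->; case: w => //= b w.
by rewrite ltn_add2l inc_addn.
Qed.

Lemma c21_addn n i w : c21 i [seq n + a | a <- w] = c21 i w.
Proof.
elim: w => //= a w ->; case: w => //= b w.
by rewrite ltn_add2l inc_addn.
Qed.

Lemma c12_max M t i : all (fun a => a < M) t -> c12 i (M :: t) = c12 i t.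
Proof.
by case: t => //= b t /andP[bM _]; rewrite ltnNge (ltnW bM) addn0.
Qed.

(** The one new descent goes from [M] to the first letter of [t], and nothing can extend it. *)
Lemma c21_max M t i : all (fun a => a < M) t ->
  c21 i (M :: t) = c21 i t + (i == 0) * (t != [::]).
Proof.
case: t => [|b t] /=; first by rewrite muln0.
case/andP => -> tM; rewrite inc_le ?muln1 //.
by apply/allP => c /(allP tM) /ltnW.
Qed.

(** * Occurrences in words of the form s m M t *)

Section MaxMin.
Variables (M m : nat) (t : seq nat).
Hypotheses (mM : m < M) (tm : all (fun a => a < m) t).

Let tM : all (fun a => a < M) t.
Proof. by apply/allP => c /(allP tm) /ltn_trans; apply. Qed.

(** An increasing subsequence above [v] avoids [m] and [t], and [M] can only close it. *)
Lemma inc_max_min v i s : m <= v -> v < M ->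
    all (fun a => m < a) s -> all (fun a => a < M) s ->
  inc v i (s ++ m :: M :: t) =
  inc v i s + (if i is i'.+1 then inc v i' s else 0).
Proof.
elim: s v i => [|a s IHs] v [|i] //=.
  move=> mv vM _ _; have vm : (v < m) = false by lia.
  rewrite vM vm addn0 !inc_le; first by case: i.
    by apply/allP => c /(allP tM) /ltnW.
  by apply/allP => c /(allP tm) /=; lia.
move=> mv vM /andP[ma ms] /andP[aM sM].
rewrite !IHs ?(ltnW ma) //; case: i => [|i] /=.
  by rewrite !inc0; case: ifP; lia.
by case: ifP => _; lia.
Qed.

(** Each occurrence in [s] may be extended by [M]; the only ascent outside [s] and [t] is [m M], the
    1 at [i = 0]. *)
Lemma c12_max_min i s :
    all (fun a => m < a) s -> all (fun a => a < M) s ->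
  c12 i (s ++ m :: M :: t) =
  c12 i s + (if i is i'.+1 then c12 i' s else 1) + c12 i t.
Proof.
elim: s => [_ _ | a s IHs /= /andP[ma ms] /andP[aM sM]].
  rewrite cat0s -[c12 i (m :: _)]/(c12 i (M :: t) +
    (if m < M then inc M i t else 0)) mM c12_max // inc_le; last first.
    by apply/allP => c /(allP tM) /ltnW.
  by case: i => [|i] /=; lia.
rewrite IHs //; case: s ms sM {IHs} => [|b s] /=.
  by rewrite ltnNge (ltnW ma); case: i => /=; lia.
move=> /andP[mb ms] /andP[bM sM].
by rewrite inc_max_min ?(ltnW mb) //; case: ifP; case: i => /=; lia.
Qed.

(** The descent from the last letter of [s] to [m] counts for [i = 0], and for [i = 1] once [M]
    extends it, hence [i <= 1]. The descent from [M] into [t] has no extension. *)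
Lemma c21_max_min i s :
    all (fun a => m < a) s -> all (fun a => a < M) s ->
  c21 i (s ++ m :: M :: t) =
  c21 i s + (if i is i'.+1 then c21 i' s else 0)
  + (i <= 1) * (s != [::]) + (i == 0) * (t != [::]) + c21 i t.
Proof.
elim: s => [_ _ | a s IHs /= /andP[ma ms] /andP[aM sM]].
  rewrite cat0s -[c21 i (m :: _)]/(c21 i (M :: t) +
    (if M < m then inc m i t else 0)) c21_max //.
  have -> : (M < m) = false by lia.
  by case: i => [|i] /=; lia.
rewrite IHs //; case: s ms sM {IHs} => [|b s] /=.
  (* For [s = [:: a]] the descent [a m] can be continued by [M] alone. *)
  move=> _ _; have := @inc_max_min a i [::] (ltnW ma) aM isT isT; rewrite /= ma.
  case: i => [|i]; rewrite /= ?aM; first lia.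
  rewrite ltnNge (ltnW ma) /= addn0 => ->; case: i => /=; lia.
move=> /andP[mb ms] /andP[bM sM].
by rewrite inc_max_min ?(ltnW ma) //; case: ifP; case: i => /=; lia.
Qed.

End MaxMin.

(** * The decomposition of Motzkin words *)

(** The alphabet starts at [m] because the parts of a decomposed word use intervals of values that
    need not start at 0. *)
Definition motzkin_words (m n : nat) : seq (seq nat) :=
  [seq w <- permutations (iota m n) | motzkin_word w].

Lemma mem_motzkin_words m n w :
  (w \in motzkin_words m n) = motzkin_word w && perm_eq w (iota m n).
Proof. by rewrite mem_filter mem_permutations. Qed.

Lemma motzkin_words_uniq m n : uniq (motzkin_words m n).
Proof. exact/filter_uniq/permutations_uniq. Qed.

Lemma motzkin_words0 m : motzkin_words m 0 = [:: [::]].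
Proof. by []. Qed.

Lemma motzkin_words_addn m n :
  perm_eq (motzkin_words m n)
          [seq [seq m + i | i <- w] | w <- motzkin_words 0 n].
Proof.
apply: uniq_perm => [||w]; first exact: motzkin_words_uniq.
  rewrite map_inj_uniq ?motzkin_words_uniq //.
  exact/inj_map/addnI.
apply/idP/mapP => [|[v]]; rewrite !mem_motzkin_words; last first.
  case/andP=> mv pv ->; rewrite motzkin_word_addn mv /=.
  by rewrite -[m in iota m]addn0 iotaDl perm_map.
case/andP=> mw pw.
(* Entries are at least [m], so the truncated subtraction loses nothing. *)
have wE : w = [seq m + i | i <- [seq i - m | i <- w]].
  rewrite -map_comp -[LHS]map_id; apply/eq_in_map => i.
  by rewrite (perm_mem pw) mem_iota /= => /andP[mi _]; rewrite subnKC.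
exists [seq i - m | i <- w] => //; rewrite mem_motzkin_words.
rewrite -(motzkin_word_addn m) -wE mw /=.
by apply: (perm_map_inj (@addnI m)); rewrite -wE -iotaDl addn0.
Qed.

(** As [s1] lies below [s2], sorting the two parts separately sorts the whole; the sorted
    arrangement is unique, so the parts fill an initial and a final segment of values. *)
Lemma perm_cat_iota (s1 s2 : seq nat) m l :
    perm_eq (s1 ++ s2) (iota m l) -> allrel leq s1 s2 ->
  perm_eq s1 (iota m (size s1)) /\ perm_eq s2 (iota (m + size s1) (size s2)).
Proof.
move=> p12 le12.
have szl : l = size s1 + size s2.
  by rewrite -size_cat (perm_size p12) size_iota.
have : sort leq s1 ++ sort leq s2 = iota m l.
  apply: (sorted_eq leq_trans anti_leq); rewrite ?iota_sorted //; last first.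
    by rewrite -(permPr p12) perm_cat ?perm_sort.
  rewrite (sorted_pairwise leq_trans) pairwise_cat.
  rewrite -!(sorted_pairwise leq_trans) !(sort_sorted leq_total) !andbT.
  by apply/allrelP => a b; rewrite !mem_sort; exact: (allrelP le12).
rewrite szl iotaD => /eqP; rewrite eqseq_cat ?size_sort ?size_iota //.
by case/andP=> /eqP <- /eqP <-; rewrite perm_sym perm_sort perm_sym perm_sort.
Qed.

Lemma motzkin_word_split m n w :
    motzkin_word w -> perm_eq w (iota m n.+1) ->
  (exists2 t, t \in motzkin_words m n & w = m + n :: t) \/
  (exists k s t, [/\ k < n, s \in motzkin_words (m + k).+1 (n - k.+1),
      t \in motzkin_words m k & w = s ++ m + k :: m + n :: t]).
Proof.
set M := m + n => mw pw.
have iotaS : iota m n.+1 = rcons (iota m n) M by rewrite -addn1 iotaD cats1.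
have : M \in w by rewrite (perm_mem pw) iotaS mem_rcons mem_head.
case/splitPr def_w: w / => [s' t]; subst w.
have pst : perm_eq (s' ++ t) (iota m n).
  have := pw; rewrite iotaS (perm_catCA s' [:: M] t).
  by rewrite perm_sym perm_rcons perm_cons perm_sym.
have ltM i : i \in s' ++ t -> i < M.
  by rewrite (perm_mem pst) mem_iota => /andP[].
have tM : all (fun i => i < M) t.
  by apply/allP => i ti; apply: ltM; rewrite mem_cat ti orbT.
have [av av'] := andP mw.
have ge_st := av132_max av tM.
(* The maximum either comes first or has a predecessor [m']. *)
case: (lastP s') => [|s m'] in pw mw pst ltM av av' ge_st *.
  left; exists t => //.
  by rewrite mem_motzkin_words pst -(motzkin_word_max tM) mw.
right.
have pts : perm_eq (t ++ m' :: s) (iota m n).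
  by rewrite -(permPr pst) perm_sym perm_catC perm_cat2l perm_rcons.
have {ge_st} le_ts : allrel leq t (m' :: s).
  apply/allrelP => i j ti js; apply: (allrelP ge_st) => //.
  by rewrite mem_rcons.
have szn : n = (size t + size s).+1.
  by rewrite -addnS -[RHS](size_cat t (m' :: s)) (perm_size pts) size_iota.
(* [t] takes the lowest values; its size will be the witness [k]. *)
have [pt pms] := perm_cat_iota pts le_ts.
have m'M : m' < M by apply: ltM; rewrite mem_cat mem_rcons mem_head.
rewrite cat_rcons in av av' mw *.
(* Avoiding 1-23 makes [m'] the least of the remaining values, hence [m + size t]. *)
have le_ms : allrel leq [:: m'] s by rewrite allrel1l (av1_23_max av').
have [] := perm_cat_iota (pms : perm_eq ([:: m'] ++ s) _) le_ms.
rewrite /= => /perm_mem/(_ m') /=; rewrite !inE eqxx => /esym/eqP m'E ps.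
subst m'; exists (size t), s, t.
have szs : n - (size t).+1 = size s by rewrite szn subSS addKn.
have ms : all (fun a => m + size t < a) s.
  by apply/allP => i; rewrite (perm_mem ps) mem_iota addn1 => /andP[].
have tm : all (fun a => a < m + size t) t.
  by apply/allP => i; rewrite (perm_mem pt) mem_iota => /andP[].
have sM : all (fun a => a < M) s.
  by apply/allP => i si; apply: ltM; rewrite mem_cat mem_rcons inE si orbT.
move: mw; rewrite motzkin_word_max_min // => /andP[mws mwt].
split; last by [].
- by rewrite szn ltnS leq_addr.
- by rewrite mem_motzkin_words mws szs; move: ps; rewrite addn1.
- by rewrite mem_motzkin_words mwt.
Qed.

(** [k] is the length of the part after the maximum, which holds the [k] lowest values; [m + k]
    precedes the maximum, and all letters before it are larger than it. *)
Definition decomposed_words m n : seq (seq nat) :=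
  [seq m + n :: t | t <- motzkin_words m n] ++
  [seq p.1 ++ m + k :: m + n :: p.2 | k <- iota 0 n,
     p <- [seq (s, t) | s <- motzkin_words (m + k).+1 (n - k.+1),
                        t <- motzkin_words m k]].

Lemma motzkin_words_bounds m n w :
  w \in motzkin_words m n -> all (fun a => m <= a < m + n) w.
Proof.
rewrite mem_motzkin_words => /andP[_ pw].
by apply/allP => a; rewrite (perm_mem pw) mem_iota.
Qed.

Lemma size_motzkin_words m n w : w \in motzkin_words m n -> size w = n.
Proof.
by rewrite mem_motzkin_words => /andP[_ /perm_size]; rewrite size_iota.
Qed.

Lemma decomposed_motzkin_word m n k s t : k < n ->
    s \in motzkin_words (m + k).+1 (n - k.+1) -> t \in motzkin_words m k ->
  [/\ all (fun a => m + k < a) s, all (fun a => a < m + n) s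
    & all (fun a => a < m + k) t].
Proof.
move=> kn /motzkin_words_bounds/allP sb /motzkin_words_bounds/allP tb.
by split; apply/allP => a; [move/sb | move/sb | move/tb] => /=; lia.
Qed.

Lemma decomposed_wordsP m n w :
  reflect
    ((exists2 t, t \in motzkin_words m n & w = m + n :: t) \/
     (exists k s t, [/\ k < n, s \in motzkin_words (m + k).+1 (n - k.+1),
        t \in motzkin_words m k & w = s ++ m + k :: m + n :: t]))
    (w \in decomposed_words m n).
Proof.
rewrite mem_cat; apply: (iffP orP) => -[].
- by case/mapP=> t wt ->; left; exists t.
- case/allpairsPdep => k [p [kn /allpairsP[[s t] [/= ws wt ->]] ->]].
  by right; exists k, s, t; rewrite mem_iota in kn.
- by case=> t wt ->; left; apply/mapP; exists t.
- case=> k [s [t [kn ws wt ->]]]; right.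
  apply/allpairsPdep; exists k, (s, t); rewrite mem_iota kn; split=> //.
  by apply/allpairsP; exists (s, t).
Qed.

Lemma decomposed_words_uniq m n : uniq (decomposed_words m n).
Proof.
(* The maximum sits at position [n - k], which recovers [k]; position 0 singles out the first
   family, as [k < n]. *)
have idx k s t : k < n -> s \in motzkin_words (m + k).+1 (n - k.+1) ->
    t \in motzkin_words m k ->
    index (m + n) (s ++ m + k :: m + n :: t) = n - k.
  move=> kn ws wt; have [_ sM _] := decomposed_motzkin_word kn ws wt.
  rewrite index_cat ifN; last by apply/negP => /(allP sM); rewrite ltnn.
  by rewrite (size_motzkin_words ws) /= eqxx eqn_add2l ltn_eqF //; lia.
rewrite cat_uniq map_inj_uniq ?motzkin_words_uniq => [/=|s t []//].
apply/andP; split.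
  apply/hasPn => w /allpairsPdep[k [p [kn /allpairsP[[s t]]]]].
  case=> /= ws wt -> -> /=; apply/negP => /mapP[u _ eqw].
  rewrite mem_iota in kn.
  by have := idx k s t kn ws wt; rewrite eqw /= eqxx; lia.
apply: allpairs_uniq_dep; first exact: iota_uniq.
  move=> k _; apply: allpairs_uniq; rewrite ?motzkin_words_uniq //.
  by case=> s t [s' t'] _ _ [-> ->].
move=> u v /allpairsPdep[k [p [kn /allpairsP[[s t] [/= ws wt ->]] ->]]].
case/allpairsPdep=> k' [p' [kn' /allpairsP[[s' t'] [/= ws' wt' ->]] ->]] /=.
rewrite !mem_iota in kn kn' => eqw.
have kk' : k = k'.
  by have := congr1 (index (m + n)) eqw; rewrite !idx //; lia.
subst k'; move/eqP: eqw; rewrite eqseq_cat; last first.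
  by rewrite (size_motzkin_words ws) (size_motzkin_words ws').
by case/andP=> /eqP -> /eqP[->].
Qed.

Lemma motzkin_words_decomposition m n :
  perm_eq (motzkin_words m n.+1) (decomposed_words m n).
Proof.
apply: uniq_perm => [||w]; first exact: motzkin_words_uniq.
  exact: decomposed_words_uniq.
apply/idP/decomposed_wordsP => [|[]]; rewrite mem_motzkin_words.
- by case/andP; exact: motzkin_word_split.
- case=> t wt ->; have tb := motzkin_words_bounds wt.
  move: wt; rewrite mem_motzkin_words => /andP[mt pt].
  rewrite motzkin_word_max ?mt; last by apply/allP => a /(allP tb) /andP[].
  by rewrite -addn1 iotaD cats1 perm_sym perm_rcons perm_cons perm_sym.
case=> k [s [t [kn ws wt ->]]].
have [ms sM tm] := decomposed_motzkin_word kn ws wt.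
move: ws wt; rewrite !mem_motzkin_words => /andP[mws ps] /andP[mwt pt].
rewrite motzkin_word_max_min ?ltn_add2l // mws mwt !andTb.
(* The values in increasing order: those of [t], then [m + k], those of [s], the maximum. *)
have -> : n.+1 = k + (1 + ((n - k.+1) + 1)) by lia.
rewrite !iotaD; apply/seq.permP => a; rewrite !count_cat /=.
rewrite (seq.permP ps) (seq.permP pt) addn1.
have -> : (m + k).+1 + (n - k.+1) = m + n by lia.
by move: (nat_of_bool _) (nat_of_bool _) (count _ _) (count _ _) => *; lia.
Qed.

Lemma big_motzkin_words (R : Type) (idx : R) (op : Monoid.com_law idx) m n
    (F : seq nat -> R) :
  \big[op/idx]_(w <- motzkin_words m n.+1) F w =
  op (\big[op/idx]_(t <- motzkin_words m n) F (m + n :: t))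
     (\big[op/idx]_(k < n)
        \big[op/idx]_(s <- motzkin_words (m + k).+1 (n - k.+1))
          \big[op/idx]_(t <- motzkin_words m k) F (s ++ m + k :: m + n :: t)).
Proof.
rewrite (perm_big _ (motzkin_words_decomposition m n)) big_cat big_map.
congr (op _ _); rewrite big_allpairs_dep -[n in iota 0 n]subn0 big_mkord.
by apply: eq_bigr => k _; rewrite big_allpairs.
Qed.

(** * Words of permutations *)

Fixpoint subseqs_of_size (T : Type) (j : nat) (w : seq T) : seq (seq T) :=
  match j, w with
  | 0, _ => [:: [::]]
  | _, [::] => [::]
  | j'.+1, a :: w' =>
      [seq a :: s | s <- subseqs_of_size j' w'] ++ subseqs_of_size j w'
  end.

Lemma mem_subseqs_of_size (T : eqType) j (w s : seq T) :
  (s \in subseqs_of_size j w) = (subseq s w) && (size s == j).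
Proof.
elim: w j s => [|a w IHw] [|j] s.
- by rewrite /= inE; case: s.
- by case: s.
- by rewrite /= inE; case: s => [|b s] //; rewrite andbF.
rewrite /= mem_cat IHw; case: s => [|b s].
  rewrite sub0seq andbF orbF; apply/mapP => -[] //.
have -> : (b :: s \in [seq a :: t | t <- subseqs_of_size j w]) =
    (b == a) && (s \in subseqs_of_size j w).
  apply/mapP/andP => [[t wt [-> ->]] | [/eqP-> ws]]; last by exists s.
  by rewrite eqxx.
rewrite IHw /= eqSS; case: eqP => [-> | _] //=.
apply/orb_idr => /andP[sub_w ->]; rewrite andbT.
exact: subseq_trans (subseq_cons s a) sub_w.
Qed.

Lemma subseqs_of_size_uniq (T : eqType) j (w : seq T) :
  uniq w -> uniq (subseqs_of_size j w).
Proof.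
elim: w j => [|a w IHw] [|j] //= /andP[aw uw].
rewrite cat_uniq IHw // map_inj_uniq ?IHw // => [|s t []//].
rewrite andbT; apply/hasPn => s; rewrite mem_subseqs_of_size => /andP[sw _].
apply/negP => /mapP[t _ def_s]; case/negP: aw; apply: (mem_subseq sw).
by rewrite def_s mem_head.
Qed.

Section PermWord.
Variables (n : nat) (p : 'S_n).

Definition perm_word : seq nat := [seq val (p i) | i <- enum 'I_n].

Lemma size_perm_word : size perm_word = n.
Proof. by rewrite size_map size_enum_ord. Qed.

Lemma nth_perm_word (i : 'I_n) : nth 0 perm_word i = p i.
Proof. by rewrite (nth_map i) ?size_enum_ord // nth_ord_enum. Qed.

Lemma avoids132_perm_word : avoids132 p = av132 perm_word.
Proof.
apply/idP/av132P => [/'forall_'forall_forallP av i j k ij jk | av].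
  rewrite size_perm_word => kn.
  have jn := ltn_trans jk kn; have jin := ltn_trans ij jn.
  have := av (Ordinal jin) (Ordinal jn) (Ordinal kn).
  by rewrite -!nth_perm_word /= ij jk.
apply/'forall_'forall_forallP => i j k; apply/negP => /and4P[ij jk pik pkj].
have := av i j k ij jk; rewrite size_perm_word !nth_perm_word pik pkj.
by move=> /(_ (ltn_ord k)).
Qed.

Lemma avoids1_23_perm_word : avoids1_23 p = av1_23 perm_word.
Proof.
apply/idP/av1_23P => [/'forall_'forall_forallP av i j ij | av].
  rewrite size_perm_word => jn.
  have jn' := ltnW jn; have jin := ltn_trans ij jn'.
  have := av (Ordinal jin) (Ordinal jn') (Ordinal jn).
  by rewrite -!nth_perm_word /= ij eqxx.
apply/'forall_'forall_forallP => i j k.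
apply/negP => /and4P[ij /eqP jk pik pkj].
have := av i j ij; rewrite -jk size_perm_word !nth_perm_word pik pkj.
by move=> /(_ (ltn_ord k)).
Qed.

Lemma mem_motzkin_perms : (p \in motzkin_perms n) = motzkin_word perm_word.
Proof. by rewrite inE avoids132_perm_word avoids1_23_perm_word. Qed.

(** Increasing index tuples are the subsequences of the enumeration of positions, on which one can
    induct as in [c12] and [c21]. *)
Lemma card_increasing_tuples j (P : pred (seq 'I_n)) :
    (forall s, P s -> sorted ltn (map val s)) ->
  #|[set s : j.-tuple 'I_n | P s]| = count P (subseqs_of_size j (enum 'I_n)).
Proof.
move=> sortedP; rewrite -size_filter cardE -(size_map val).
apply/perm_size/uniq_perm => [||s].
- by rewrite (map_inj_uniq val_inj) enum_uniq.
- by rewrite filter_uniq // subseqs_of_size_uniq // enum_uniq.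
rewrite mem_filter mem_subseqs_of_size; apply/mapP/idP => [[t] | ].
  rewrite mem_enum inE => Pt ->; rewrite Pt size_tuple eqxx andbT /=.
  have ltn_val_trans : transitive (relpre (val : 'I_n -> nat) ltn).
    by move=> i k l; apply: ltn_trans.
  (* Two increasing lists with the same elements coincide. *)
  have -> : tval t = [seq i <- enum 'I_n | i \in tval t].
    apply: (irr_sorted_eq ltn_val_trans) => [i|||i]; first exact: ltnn.
    - by rewrite -sorted_map sortedP.
    - by rewrite sorted_filter // -sorted_map val_enum_ord iota_ltn_sorted.
    - by rewrite mem_filter mem_enum andbT.
  exact: filter_subseq.
case/and3P=> Ps _ sz; exists (Tuple sz) => //.
by rewrite mem_enum inE.
Qed.

(** On such lists, neighbours are adjacent positions; the property passes to tails, as induction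
    needs. *)
Definition consecutive (s : seq 'I_n) :=
  sorted (fun a b : 'I_n => b == a.+1 :> nat) s.

Lemma consecutive_sorted s : consecutive s -> sorted ltn (map val s).
Proof.
rewrite sorted_map; apply: sub_sorted => a b /eqP ab.
by rewrite /= ab.
Qed.

Lemma consecutive_enum : consecutive (enum 'I_n).
Proof.
have : sorted (fun a b => b == a.+1) (map val (enum 'I_n)).
  rewrite val_enum_ord; elim: n 0 => // -[|k] //= IHk a.
  by rewrite eqxx; apply: (IHk a.+1).
by rewrite sorted_map.
Qed.

Lemma count_path_inc v j (u : seq 'I_n) :
  count (fun s => path ltn v [seq val (p i) | i <- s]) (subseqs_of_size j u) =
  inc v j [seq val (p i) | i <- u].
Proof.
elim: u v j => [|a u IHu] v [|j] //=.
rewrite count_cat IHu addnC count_map; congr (_ + _).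
case: ifP => lt_va; rewrite -?IHu; last first.
  by apply: etrans (count_pred0 _); apply: eq_count => s /=; rewrite lt_va.
by apply: eq_count => s /=; rewrite lt_va.
Qed.

(** Treats 12 and 21 together: [Q] is the required order of the two adjacent values and [top] stands
    for the larger one, which the later values must exceed. *)
Lemma count_occ_adjacent (occ : pred (seq 'I_n)) (Q : rel 'I_n)
    (top : 'I_n -> 'I_n -> nat) j a b (u : seq 'I_n) :
    (forall a b s, occ [:: a, b & s] =
       [&& b == a.+1 :> nat, sorted ltn (map val [:: a, b & s]), Q a b
         & path ltn (top a b) [seq val (p i) | i <- s]]) ->
    consecutive [:: a, b & u] ->
  count (fun s => occ (a :: s)) (subseqs_of_size j.+1 (b :: u)) =
  if Q a b then inc (top a b) j [seq val (p i) | i <- u] else 0.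
Proof.
move=> occE cons_u; have [/eqP ab _] := andP cons_u.
have sorted_u := consecutive_sorted cons_u.
rewrite [subseqs_of_size _ _]/= count_cat count_map -[RHS]addn0.
congr (_ + _).
  transitivity (count (fun s => Q a b &&
      path ltn (top a b) [seq val (p i) | i <- s]) (subseqs_of_size j u)).
    apply: eq_in_count => s; rewrite mem_subseqs_of_size => /andP[su _].
    rewrite /= occE ab eqxx andTb andb_idl // => _.
    apply: subseq_sorted sorted_u; first exact: ltn_trans.
    by apply: map_subseq; rewrite /= !eqxx.
  case: ifP => _; last exact: count_pred0.
  exact: count_path_inc.
(* Choices that skip [b] contribute nothing: their second index lies beyond [b = a + 1]. *)
apply/eqP; rewrite -leqn0 leqNgt -has_count; apply/hasPn => -[|c s].
  by rewrite mem_subseqs_of_size andbF.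
rewrite mem_subseqs_of_size => /andP[/mem_subseq/(_ c (mem_head _ _)) cu _].
rewrite occE -ab; apply/negP => /andP[/eqP/val_inj cb _].
move: sorted_u; rewrite /= (path_sortedE ltn_trans) => /and3P[_ /allP lt_b _].
have /lt_b : val c \in map val u by rewrite mem_map //; apply: val_inj.
by rewrite /= cb ltnn.
Qed.

Lemma count_occ12 j (u : seq 'I_n) : consecutive u ->
  count (is_occ12 p) (subseqs_of_size j.+2 u) =
  c12 j [seq val (p i) | i <- u].
Proof.
elim: u => // a [|b u] IHu cons_u //.
have [_ cons_bu] := andP cons_u.
rewrite -[subseqs_of_size _ _]/(
  [seq a :: s | s <- subseqs_of_size j.+1 (b :: u)] ++
  subseqs_of_size j.+2 (b :: u)).
rewrite count_cat (IHu cons_bu) addnC count_map /=; congr (_ + _).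
by rewrite -(@count_occ_adjacent (is_occ12 p) (fun a b => p a < p b)
  (fun a b => p b) j a b u).
Qed.

Lemma count_occ21 j (u : seq 'I_n) : consecutive u ->
  count (is_occ21 p) (subseqs_of_size j.+2 u) =
  c21 j [seq val (p i) | i <- u].
Proof.
elim: u => // a [|b u] IHu cons_u //.
have [_ cons_bu] := andP cons_u.
rewrite -[subseqs_of_size _ _]/(
  [seq a :: s | s <- subseqs_of_size j.+1 (b :: u)] ++
  subseqs_of_size j.+2 (b :: u)).
rewrite count_cat (IHu cons_bu) addnC count_map /=; congr (_ + _).
by rewrite -(@count_occ_adjacent (is_occ21 p) (fun a b => p b < p a)
  (fun a b => p a) j a b u).
Qed.

Lemma occ12_perm_word j : occ12 p j.+2 = c12 j perm_word.
Proof.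
rewrite -(count_occ12 _ consecutive_enum) -card_increasing_tuples //.
by case=> [|a [|b s]] // /and3P[].
Qed.

Lemma occ21_perm_word j : occ21 p j.+2 = c21 j perm_word.
Proof.
rewrite -(count_occ21 _ consecutive_enum) -card_increasing_tuples //.
by case=> [|a [|b s]] // /and3P[].
Qed.

End PermWord.

Lemma perm_word_inj n : injective (@perm_word n).
Proof.
move=> p q eq_pq; apply/permP => i; apply: val_inj.
by have := congr1 (fun w => nth 0 w i) eq_pq; rewrite !nth_perm_word.
Qed.

Lemma perm_word_iota n (p : 'S_n) : perm_eq (perm_word p) (iota 0 n).
Proof.
rewrite -val_enum_ord /perm_word (map_comp val p) perm_map //.
apply: uniq_perm => [||i]; rewrite ?(map_inj_uniq perm_inj) ?enum_uniq //.
rewrite mem_enum; apply/mapP; exists (p^-1 i)%g; rewrite ?mem_enum //.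
by rewrite permKV.
Qed.

(** An injection between sets of [n!] elements is onto. *)
Lemma perm_words n :
  perm_eq [seq perm_word p | p <- enum 'S_n] (permutations (iota 0 n)).
Proof.
have uw : uniq [seq perm_word p | p <- enum 'S_n].
  by rewrite map_inj_uniq ?enum_uniq //; apply: perm_word_inj.
apply: uniq_perm; rewrite ?permutations_uniq //.
apply: (uniq_min_size uw _ _).2.
  by move=> _ /mapP[p _ ->]; rewrite mem_permutations perm_word_iota.
rewrite size_permutations ?iota_uniq // size_iota size_map -cardE.
by rewrite card_Sn.
Qed.

(** * The recurrence for the coefficients *)

Local Open Scope ring_scope.

Section WordGf.
Variable R : comNzRingType.
Implicit Types x y : nat -> R.

(** The cut at [size w] is harmless, as longer patterns do not occur. *)
Definition word_weight x y (w : seq nat) : R :=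
  \prod_(i < size w) (x i.+2 ^+ c12 i w * y i.+2 ^+ c21 i w).

Lemma word_weight_widen x y w N : (size w <= N)%N ->
  word_weight x y w = \prod_(i < N) (x i.+2 ^+ c12 i w * y i.+2 ^+ c21 i w).
Proof.
move=> le_wN; rewrite /word_weight.
rewrite (big_ord_widen N (fun i => x i.+2 ^+ c12 i w * y i.+2 ^+ c21 i w)) //.
rewrite big_mkcond; apply: eq_bigr => i _; case: ltnP => // wi.
by rewrite c12_ge_size // c21_ge_size // !expr0 mulr1.
Qed.

Lemma word_weight_addn x y m w :
  word_weight x y [seq (m + i)%N | i <- w] = word_weight x y w.
Proof.
rewrite /word_weight size_map; apply: eq_bigr => i _.
by rewrite c12_addn c21_addn.
Qed.

Lemma word_weight_max x y M t : all (fun a => a < M)%N t ->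
  word_weight x y (M :: t) = y 2%N ^+ (t != [::]) * word_weight x y t.
Proof.
move=> tM; rewrite [RHS]mulrC (@word_weight_widen x y t (size t).+1) //.
rewrite /word_weight -[size (M :: t)]/(size t).+1 !big_ord_recl.
rewrite c12_max // c21_max // mul1n exprD mulrA [RHS]mulrAC.
by congr (_ * _); apply: eq_bigr => i _; rewrite c12_max // c21_max // addn0.
Qed.

(** The extra factor counts each occurrence again with one letter more, which is the effect of a
    maximum placed after the word. *)
Lemma word_weight_shift x y w :
  word_weight (shift_vars x) (shift_vars y) w =
  word_weight x y w *
  \prod_(i < size w) (x i.+3 ^+ c12 i w * y i.+3 ^+ c21 i w).
Proof.
rewrite /word_weight -big_split; apply: eq_bigr => i _ /=.
by rewrite !exprMn mulrACA.
Qed.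

(** The factors are [x_2] for [m M], [y_2 y_3] for the descent into [m] and its extension by [M],
    and [y_2] for the descent after [M]; the shifted weight of [s] includes the occurrences extended
    by [M]. *)
Lemma word_weight_max_min x y M m s t : (m < M)%N ->
    all (fun a => m < a)%N s -> all (fun a => a < M)%N s ->
    all (fun a => a < m)%N t ->
  word_weight x y (s ++ m :: M :: t) =
  x 2%N * (y 2%N * y 3%N) ^+ (s != [::]) * y 2%N ^+ (t != [::])
  * word_weight (shift_vars x) (shift_vars y) s * word_weight x y t.
Proof.
move=> mM ms sM tm; set N := (size s + size t)%N.
rewrite word_weight_shift (@word_weight_widen x y (_ ++ _) N.+2); last first.
  by rewrite size_cat /=; lia.
rewrite (@word_weight_widen x y s N.+2); last by rewrite /N; lia.
rewrite (@word_weight_widen x y t N.+2); last by rewrite /N; lia.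
(* One factor fewer than [N.+2]: this range remains once [i = 0] is split off below. *)
have -> : \prod_(i < size s) (x i.+3 ^+ c12 i s * y i.+3 ^+ c21 i s) =
    \prod_(i < N.+1) (x i.+3 ^+ c12 i s * y i.+3 ^+ c21 i s).
  pose F i := x i.+3 ^+ c12 i s * y i.+3 ^+ c21 i s.
  rewrite (big_ord_widen N.+1 F) ?big_mkcond; last by rewrite /N; lia.
  apply: eq_bigr => i _; rewrite /F; case: ltnP => // si.
  by rewrite c12_ge_size // c21_ge_size // !expr0 mulr1.
rewrite (eq_bigr (fun i : 'I_N.+2 =>
    (x i.+2 ^+ c12 i s * y i.+2 ^+ c21 i s)
    * (x i.+2 ^+ c12 i t * y i.+2 ^+ c21 i t)
    * (x i.+2 ^+ (if nat_of_ord i is i'.+1 then c12 i' s else 1%N)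
       * (y i.+2 ^+ (if nat_of_ord i is i'.+1 then c21 i' s else 0%N)
       * (y i.+2 ^+ ((i <= 1) * (s != [::]))
          * y i.+2 ^+ ((nat_of_ord i == 0%N) * (t != [::]))))))); last first.
  by move=> i _; rewrite c12_max_min // c21_max_min // !exprD; ring.
rewrite !big_split /=.
have -> (b : bool) : \prod_(i < N.+2) y i.+2 ^+ ((i <= 1) * b) =
    (y 2%N * y 3%N) ^+ b.
  rewrite !big_ord_recl big1 => [|i _]; last by rewrite mul0n expr0.
  by rewrite !mul1n mulr1 exprMn.
have -> (b : bool) : \prod_(i < N.+2) y i.+2 ^+ ((nat_of_ord i == 0%N) * b) =
    y 2%N ^+ b.
  rewrite big_ord_recl big1 => [|i _]; last by rewrite mul0n expr0.
  by rewrite mul1n mulr1.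
rewrite [X in _ * (X * _)]big_ord_recl [X in _ * (_ * (X * _))]big_ord_recl /=.
by rewrite expr1 expr0 mul1r; ring.
Qed.

Definition word_gf x y m n : R :=
  \sum_(w <- motzkin_words m n) word_weight x y w.

Lemma word_gf_addn x y m n : word_gf x y m n = word_gf x y 0 n.
Proof.
rewrite /word_gf (perm_big _ (motzkin_words_addn m n)) big_map.
by apply: eq_bigr => w _; rewrite word_weight_addn.
Qed.

Lemma word_gf0 x y m : word_gf x y m 0 = 1.
Proof. by rewrite /word_gf motzkin_words0 big_seq1 /word_weight big_ord0. Qed.

(** [k] is the length of [t]; the exponents 0 or 1 record which parts are nonempty. *)
Lemma word_gfS x y n :
  word_gf x y 0 n.+1 =
  y 2%N ^+ (n != 0)%N * word_gf x y 0 n +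
  x 2%N * \sum_(k < n) ((y 2%N * y 3%N) ^+ (n - k.+1 != 0)%N
                      * word_gf (shift_vars x) (shift_vars y) 0 (n - k.+1))
                     * (y 2%N ^+ (k != 0 :> nat) * word_gf x y 0 k).
Proof.
rewrite {1}/word_gf big_motzkin_words; congr (_ + _).
  rewrite /word_gf mulr_sumr; apply: eq_big_seq => t wt.
  have tb := motzkin_words_bounds wt.
  rewrite word_weight_max ?(size_eq0, (motzkin_words_bounds wt)) //.
  by rewrite -size_eq0 (size_motzkin_words wt).
rewrite mulr_sumr; apply: eq_bigr => k _.
(* The sum for [s] is moved back to its own interval of values. *)
rewrite -(word_gf_addn _ _ (0 + k).+1) mulrACA /word_gf big_distrlr mulrA /=.
rewrite mulr_sumr; apply: eq_big_seq => s ws.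
rewrite mulr_sumr; apply: eq_big_seq => t wt.
have [ms sM tm] := decomposed_motzkin_word (ltn_ord k) ws wt.
rewrite word_weight_max_min ?ltn_add2l //.
rewrite -!size_eq0 (size_motzkin_words wt) (size_motzkin_words ws); ring.
Qed.

End WordGf.

Lemma motzkin_gfE (R : comNzRingType) (x y : nat -> R) n :
  motzkin_gf x y n = word_gf x y 0 n.
Proof.
rewrite /word_gf /motzkin_words big_filter -(perm_big _ (perm_words n)) /=.
rewrite big_map big_enum_cond; apply: eq_big => p.
  exact: mem_motzkin_perms.
move=> _; rewrite /word_weight size_perm_word.
case: n p => [|n] p; first by rewrite big_geq ?big_ord0.
(* The weight has one factor more, for patterns of length [n + 2], too long for [n + 1] letters. *)
rewrite big_ord_recr /= -occ12_perm_word -occ21_perm_word.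
rewrite occ12_eq0 // occ21_eq0 // !expr0 !mulr1.
rewrite -[2%N]/(0 + 2)%N big_addn big_mkord.
rewrite subSS subn1; apply: eq_bigr => i _.
by rewrite addn2 occ12_perm_word occ21_perm_word.
Qed.

(** * The functional equation and the continued fraction *)

Section FpsCoef.
Variable R : comNzRingType.
Implicit Types (f g : fps R) (c : R).

Lemma fps_coefD f g n : (f + g) n = f n + g n.
Proof. by []. Qed.

Lemma fps_coefN f n : (- f) n = - f n.
Proof. by []. Qed.

Lemma fps_coefCM c f n : (c%:S * f) n = c * f n.
Proof.
rewrite fps_coefM big_ord_recl /= subn0 big1 ?addr0 // => i _.
by rewrite mul0r.
Qed.

Lemma fps_coefTM f n : (fpsT * f) n = if n is n'.+1 then f n' else 0.
Proof.
rewrite fps_coefM; case: n => [|n]; first by rewrite big_ord1 mul0r.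
rewrite 2!big_ord_recl /= mul0r mul1r add0r subn1 big1 ?addr0 // => i _.
by rewrite mul0r.
Qed.

Lemma fps_coefTMS f n : (fpsT * f) n.+1 = f n.
Proof. by rewrite fps_coefTM. Qed.

Lemma fpsCM c d : (c * d)%:S = c%:S * d%:S.
Proof.
by apply/fpsP => n; rewrite fps_coefCM /=; case: eqP; rewrite ?mulr0.
Qed.

Lemma unit_1DT f : 1 + fpsT * f \is a GRing.unit.
Proof.
apply/fps_unitP; exists 1.
by rewrite mul1r fps_coefD fps_coef1 fps_coefTM addr0.
Qed.

Lemma fps_inv_coef0 f : f \is a GRing.unit -> f 0%N = 1 -> f^-1 0%N = 1.
Proof.
move=> uf f0; have /fpsP/(_ 0%N) := mulrV uf.
by rewrite fps_coefM big_ord1 subn0 f0 mul1r fps_coef1.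
Qed.

Lemma fps_coef_T_sub_inv f g : g \is a GRing.unit -> g 0%N = 1 ->
  (fpsT * f - 1 / g) 0%N = -1.
Proof.
move=> ug g0.
by rewrite div1r fps_coefD fps_coefN fps_coefTM fps_inv_coef0 // add0r.
Qed.

Lemma unit_T_sub_inv f g : g \is a GRing.unit -> g 0%N = 1 ->
  fpsT * f - 1 / g \is a GRing.unit.
Proof.
move=> ug g0; apply/fps_unitP; exists (-1).
by rewrite fps_coef_T_sub_inv // mulrNN mulr1.
Qed.

(** Congruence modulo [t^(m+1)]. *)
Definition fps_eqmod m f g := forall n, (n <= m)%N -> f n = g n.

Lemma fps_eqmodD m f f' g g' :
  fps_eqmod m f f' -> fps_eqmod m g g' -> fps_eqmod m (f + g) (f' + g').
Proof. by move=> ff gg n nm; rewrite !fps_coefD ff ?gg. Qed.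

Lemma fps_eqmodN m f f' : fps_eqmod m f f' -> fps_eqmod m (- f) (- f').
Proof. by move=> ff n nm; rewrite !fps_coefN ff. Qed.

Lemma fps_eqmodM m f f' g g' :
  fps_eqmod m f f' -> fps_eqmod m g g' -> fps_eqmod m (f * g) (f' * g').
Proof.
move=> ff gg n nm; rewrite !fps_coefM; apply: eq_bigr => i _.
rewrite ff ?gg //; first by rewrite (leq_trans _ nm) ?leq_subr.
by rewrite (leq_trans _ nm) // -ltnS.
Qed.

Lemma fps_eqmodT m f f' :
  fps_eqmod m f f' -> fps_eqmod m.+1 (fpsT * f) (fpsT * f').
Proof. by move=> ff [|n] nm; rewrite !fps_coefTM // ff. Qed.

(** This rests on [f^-1 - g^-1 = f^-1 (g - f) g^-1]. *)
Lemma fps_eqmodV m f g : f \is a GRing.unit -> g \is a GRing.unit ->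
  fps_eqmod m f g -> fps_eqmod m f^-1 g^-1.
Proof.
move=> uf ug fg.
have : fps_eqmod m (f^-1 * (g * g^-1)) (f^-1 * (f * g^-1)).
  do 2!apply: fps_eqmodM => //; move=> n nm; symmetry; exact: fg.
by rewrite mulrV // mulr1 mulKr.
Qed.

Lemma fps_eqmod_T_sub_inv m f g g' :
    g \is a GRing.unit -> g 0%N = 1 -> g' \is a GRing.unit -> g' 0%N = 1 ->
  fps_eqmod m g g' ->
  fps_eqmod m (fpsT * f - 1 / g)^-1 (fpsT * f - 1 / g')^-1.
Proof.
move=> ug g0 ug' g0' gg'; apply: fps_eqmodV; rewrite ?unit_T_sub_inv //.
apply: fps_eqmodD => //; apply: fps_eqmodN; rewrite !div1r.
exact: fps_eqmodV.
Qed.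

End FpsCoef.

(** * From the recurrence to the fraction and its iteration *)

Section FunctionalEquation.
Variable R : comNzRingType.
Implicit Types x y : nat -> R.

(** The innermost denominator of the functional equation; with shifted variables it reappears at
    every level of the continued fraction. *)
Definition motzkin_denom x y : fps R :=
  1 + fpsT * (x 2%N)%:S * (1 - (y 2%N)%:S * (y 3%N)%:S)
    + fpsT * (x 2%N)%:S * (y 2%N)%:S * (y 3%N)%:S
      * motzkin_gf (shift_vars x) (shift_vars y).

Lemma motzkin_denomE x y : motzkin_denom x y =
  1 + fpsT * ((x 2%N)%:S * (1 - (y 2%N)%:S * (y 3%N)%:S
    + (y 2%N)%:S * (y 3%N)%:S * motzkin_gf (shift_vars x) (shift_vars y))).
Proof. by rewrite /motzkin_denom; ring. Qed.

Lemma motzkin_denom_unit x y : motzkin_denom x y \is a GRing.unit.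
Proof. by rewrite motzkin_denomE unit_1DT. Qed.

Lemma motzkin_denom_coef0 x y : motzkin_denom x y 0%N = 1.
Proof. by rewrite motzkin_denomE fps_coefD fps_coef1 fps_coefTM addr0. Qed.

(** An additional [c] for each nonempty word turns the case distinctions of [word_gfS] into
    series. *)
Lemma motzkin_gf_nonempty x y (c : R) n :
  (1 + c%:S * (motzkin_gf x y - 1)) n = c ^+ (n != 0)%N * word_gf x y 0 n.
Proof.
rewrite fps_coefD fps_coef1 fps_coefCM fps_coefD fps_coefN fps_coef1.
rewrite motzkin_gfE.
case: n => [|n] /=; first by rewrite word_gf0; ring.
by rewrite expr1; ring.
Qed.

(** The sum over [k] in [word_gfS] is the Cauchy product of [B] and [C], and [motzkin_denom] is
    [1 + t x_2 C]. *)
Lemma motzkin_gf_rec x y :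
  motzkin_gf x y =
  1 + fpsT * motzkin_denom x y * (1 + (y 2%N)%:S * (motzkin_gf x y - 1)).
Proof.
set B := 1 + (y 2%N)%:S * _.
pose C := 1 + (y 2%N * y 3%N)%:S *
  (motzkin_gf (shift_vars x) (shift_vars y) - 1).
have -> : fpsT * motzkin_denom x y * B =
    fpsT * (B + (x 2%N)%:S * (fpsT * (C * B))).
  by rewrite motzkin_denomE /C fpsCM; ring.
apply/fpsP => -[|n]; rewrite motzkin_gfE fps_coefD fps_coef1.
  by rewrite word_gf0 fps_coefTM addr0.
rewrite add0r word_gfS fps_coefTMS fps_coefD fps_coefCM motzkin_gf_nonempty.
congr (_ + _ * _); case: n => [|n]; first by rewrite big_ord0 fps_coefTM.
rewrite fps_coefTMS [C * B]mulrC fps_coefM; apply: eq_bigr => k _.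
by rewrite !motzkin_gf_nonempty mulrC subSS.
Qed.

(** The recurrence is linear in [F]: [(F - 1) (t y_2 D - 1) = - t D]. Cancelling the invertible [D]
    gives [(F - 1) E = - t], and [E] is invertible too. *)
Lemma motzkin_gf_fraction x y :
  motzkin_gf x y = 1 - fpsT / (fpsT * (y 2%N)%:S - 1 / motzkin_denom x y).
Proof.
have uD := motzkin_denom_unit x y.
set D := motzkin_denom x y in uD *; set E := fpsT * _ - _.
have uE : E \is a GRing.unit by apply: unit_T_sub_inv (motzkin_denom_coef0 x y).
have DE : D * E = fpsT * (y 2%N)%:S * D - 1.
  by rewrite /E mulrBr div1r mulrV // mulrC.
have FE : (motzkin_gf x y - 1) * E = - fpsT.
  apply: (mulrI uD); rewrite mulrCA DE.
  have := motzkin_gf_rec x y; rewrite -/D; set F := motzkin_gf x y => Frec.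
  have -> : (F - 1) * (fpsT * (y 2%N)%:S * D - 1) =
      1 + fpsT * D * (1 + (y 2%N)%:S * (F - 1)) - fpsT * D - F by ring.
  by rewrite -Frec; ring.
by rewrite -mulNr -FE mulrK // addrC subrK.
Qed.

(** Once the inner series is replaced by its own fraction, the terms [t x_2 y_2 y_3] cancel. *)
Lemma motzkin_denom_rec x y :
  motzkin_denom x y =
  1 + fpsT * (x 2%N)%:S
  - (fpsT ^+ 2 * (x 2%N)%:S * (shift_vars y 2%N)%:S)
    / (fpsT * (shift_vars y 2%N)%:S
       - 1 / motzkin_denom (shift_vars x) (shift_vars y)).
Proof. by rewrite {1}/motzkin_denom motzkin_gf_fraction fpsCM; ring. Qed.

(** Exponents add by Pascal's rule, which gives the binomials of [cf_mon]. *)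
Lemma iter_shift_vars x k j :
  iter k (@shift_vars R) x j = \prod_(i < k.+1) x (i + j)%N ^+ 'C(k, i).
Proof.
elim: k j => [|k IHk] j; first by rewrite big_ord1 bin0 expr1.
rewrite iterS /shift_vars !IHk.
rewrite [RHS]big_ord_recl bin0 /=.
under [X in _ = _ * X]eq_bigr => i _ do rewrite binS exprD.
rewrite big_split /= mulrA; congr (_ * _); last first.
  by apply: eq_bigr => i _; rewrite addSnnS.
rewrite big_ord_recl bin0 big_ord_recr bin_small //= expr0 mulr1.
by [].
Qed.

Lemma cf_monE x k : cf_mon x k = iter k (@shift_vars R) x 2%N.
Proof. by rewrite iter_shift_vars; apply: eq_bigr => i _; rewrite addn2. Qed.

(** The shape [1 + t f] makes the tail, and every denominator built from it, invertible. *)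
Lemma cf_tail_unit x y m k :
  (cf_tail x y m k \is a GRing.unit) /\ cf_tail x y m k 0%N = 1.
Proof.
have [f ->] : exists f, cf_tail x y m k = 1 + fpsT * f.
  case: m => [|m] /=; first by exists (cf_mon x k)%:S.
  set E := _ - 1 / _.
  exists ((cf_mon x k)%:S
    - fpsT * (cf_mon x k)%:S * (cf_mon y k.+1)%:S / E).
  by ring.
by rewrite unit_1DT fps_coefD fps_coef1 fps_coefTM addr0.
Qed.

(** [motzkin_denom_rec] is the recursion of [cf_tail]; an error at the next level is multiplied by
    [t], so each step gains one order. With no steps left, both constant terms are 1. *)
Lemma cf_tail_eqmod x y m k :
  fps_eqmod m (cf_tail x y m k)
    (motzkin_denom (iter k (@shift_vars R) x) (iter k (@shift_vars R) y)).
Proof.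
elim: m k => [|m IHm] k.
  move=> n; rewrite leqn0 => /eqP->.
  by rewrite motzkin_denom_coef0 (cf_tail_unit x y 0 k).2.
rewrite motzkin_denom_rec -!iterS -!cf_monE /=.
have [uc c0] := cf_tail_unit x y m k.+1.
apply: fps_eqmodD => //; apply: fps_eqmodN.
rewrite expr2 -!mulrA; apply: fps_eqmodT; do 3!apply: fps_eqmodM => //.
by apply: fps_eqmod_T_sub_inv; rewrite ?motzkin_denom_unit ?motzkin_denom_coef0.
Qed.

End FunctionalEquation.

Theorem theorem3p11 (R : comNzRingType) (x y : nat -> R) :
  let F := motzkin_gf x y in
  let F' := motzkin_gf (shift_vars x) (shift_vars y) in
  F = 1 - fpsT / (fpsT * (y 2%N)%:S
                  - 1 / (1 + fpsT * (x 2%N)%:S * (1 - (y 2%N)%:S * (y 3%N)%:S)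
                         + fpsT * (x 2%N)%:S * (y 2%N)%:S * (y 3%N)%:S * F'))
  /\ fps_cvg (cf_convergent x y) F.
Proof.
split; first exact: motzkin_gf_fraction.
(* The convergent with [m] steps is correct through [t^m], so the threshold [n] serves coefficient
   [n]. *)
move=> n; exists n => m; move: n.
rewrite -/(fps_eqmod m (cf_convergent x y m) (motzkin_gf x y)).
rewrite motzkin_gf_fraction /cf_convergent cf_monE.
have [uc c0] := cf_tail_unit x y m 0.
apply: fps_eqmodD => //; apply: fps_eqmodN; apply: fps_eqmodM => //.
apply: fps_eqmod_T_sub_inv; rewrite ?motzkin_denom_unit ?motzkin_denom_coef0 //.
exact: cf_tail_eqmod x y m 0.
Qed.
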